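(* Let $\alpha\in(0,1)$, let $r\in\mathbb D\setminus\{0\}$ (a complex number), and let $\varphi(z)=rz$ for $z\in\mathbb D$. Put $$f(x)=x^{\frac{3-\alpha}{2}}(x+1)^{\frac{\alpha-1}{2}}|r|^{x-1}\quad (x\ge 0),$$ $$x_0=\frac{-(1+\log|r|)-\sqrt{(1+\log|r|)^2-2(3-\alpha)\log|r|}}{2\log|r|}.$$ Then the operator norm of $D_\varphi$ on $\mathcal D_\alpha$ is $$\|D_\varphi\|=\begin{cases}(\lfloor x_0\rfloor+1)^{\frac{3-\alpha}{2}}(\lfloor x_0\rfloor+2)^{\frac{\alpha-1}{2}}|r|^{\lfloor x_0\rfloor}, & \text{if } f(\lfloor x_0\rfloor)<f(\lfloor x_0\rfloor+1),\\[4pt] \lfloor x_0\rfloor^{\frac{3-\alpha}{2}}(\lfloor x_0\rfloor+1)^{\frac{\alpha-1}{2}}|r|^{\lfloor x_0\rfloor-1}, & \text{otherwise.}\end{cases}$$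
   Context: $\mathbb D=\{z\in\mathbb C:|z|<1\}$, $\lfloor\cdot\rfloor$ is the floor function and $\log$ the natural logarithm. The weighted Dirichlet space $\mathcal D_\alpha$ consists of all holomorphic $g(z)=\sum_{n\ge0}a_nz^n$ on $\mathbb D$ with $\|g\|_{\mathcal D_\alpha}^2=\sum_{n\ge0}(n+1)^{1-\alpha}|a_n|^2<\infty$; it is a Hilbert space with inner product $\langle g,h\rangle_{\mathcal D_\alpha}=\sum_{n\ge0}(n+1)^{1-\alpha}a_n\overline{b_n}$ for $h(z)=\sum_{n\ge0} b_nz^n$. The composition-differentiation operator is $D_\varphi g=g'\circ\varphi$, and $\|D_\varphi\|$ denotes its operator norm on $\mathcal D_\alpha$ with respect to $\|\cdot\|_{\mathcal D_\alpha}$. *)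

(* Defs.v *)
From Stdlib Require Import Reals Lra ClassicalEpsilon.
From Coquelicot Require Import Coquelicot.
Open Scope R_scope.

(* Functions on the unit disc D are total functions C -> C of which only the
   values on D = { z | Cmod z < 1 } are used. *)

Definition holomorphic_on_disc (g : C -> C) : Prop :=
  forall z : C, Cmod z < 1 ->
    ex_derive (K := C_AbsRing) (V := C_NormedModule) g z.

Definition has_expansion (g : C -> C) (a : nat -> C) : Prop :=
  forall z : C, Cmod z < 1 ->
    is_pseries (K := C_AbsRing) (V := C_NormedModule) a z (g z).

(* Unspecified when g has no expansion on D; see [coeffs_unique]. *)
Definition coeffs (g : C -> C) : nat -> C :=
  epsilon (inhabits (fun _ : nat => RtoC 0)) (has_expansion g).

Lemma has_expansion_unique (g : C -> C) (a b : nat -> C) :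
  has_expansion g a -> has_expansion g b -> forall n, a n = b n.
Proof.
intros Ha Hb n.
(* Restrict to the real axis and apply a continuous R-linear projection. *)
assert (key : forall p : C -> R,
  (forall u v, p (Cplus u v) = p u + p v) ->
  (forall (x : R) v, p (Cmult (RtoC x) v) = x * p v) ->
  (forall u, filterlim p (locally u) (locally (p u))) ->
  p (a n) = p (b n)).
{ intros p Hadd Hscal Hcont.
  assert (E : forall c : nat -> C, has_expansion g c ->
            forall x : R, Rabs x < 1 ->
            is_pseries (fun k => p (c k)) x (p (g (RtoC x)))).
  { intros c Hc x Hx.
    assert (Hz : Cmod (RtoC x) < 1) by (rewrite Cmod_R; exact Hx).
    specialize (Hc _ Hz). unfold is_pseries, is_series in *.
    eapply filterlim_ext; [ | exact (filterlim_comp _ _ _ _ p _ _ _ Hc (Hcont _))].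
    intros N; simpl.
    assert (T : forall k, p (scal (pow_n (RtoC x : C_AbsRing) k) (c k : C_NormedModule))
                          = scal (pow_n x k) (p (c k))).
    { intros k.
      assert (P : (pow_n (RtoC x : C_AbsRing) k : C) = RtoC (pow_n x k)).
      { induction k as [|k IH]; simpl; [reflexivity|].
        rewrite IH. unfold mult; simpl. unfold mult; simpl.
        now rewrite RtoC_mult. }
      rewrite P. apply Hscal. }
    induction N as [|N IH].
    - rewrite !sum_O. apply T.
    - rewrite !sum_Sn, <- IH, <- T. apply Hadd. }
  assert (R1 : forall c : nat -> C, has_expansion g c ->
            Rbar_lt 0 (CV_radius (fun k => p (c k)))).
  { intros c Hc.
    apply Rbar_lt_le_trans with (Finite (/ 2)); [simpl; lra|].
    rewrite <- (Rabs_pos_eq (/ 2)) by lra.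
    apply Rbar_not_lt_le.
    intros Hlt. apply CV_disk_outside in Hlt.
    apply Hlt.
    apply (ex_series_lim_0 (fun k => p (c k) * (/ 2) ^ k)).
    exists (p (g (RtoC (/ 2)))). apply is_pseries_R, E; [exact Hc|].
    rewrite Rabs_pos_eq; lra. }
  apply (PSeries_ext_recip (fun k => p (a k)) (fun k => p (b k)) n (R1 a Ha) (R1 b Hb)).
  exists (mkposreal 1 Rlt_0_1). intros x Hx.
  assert (Hx' : Rabs x < 1).
  { unfold ball in Hx; simpl in Hx; unfold AbsRing_ball, abs, minus, plus, opp in Hx;
    simpl in Hx. now rewrite Ropp_0, Rplus_0_r in Hx. }
  rewrite (is_pseries_unique _ _ _ (E a Ha x Hx')).
  now rewrite (is_pseries_unique _ _ _ (E b Hb x Hx')). }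
apply injective_projections; apply key.
- intros [] []; reflexivity.
- intros x []; simpl; ring.
- intros [u1 u2] P [d Hd]; exists d; intros y [Hy _]; apply Hd, Hy.
- intros [] []; reflexivity.
- intros x []; simpl; ring.
- intros [u1 u2] P [d Hd]; exists d; intros y [_ Hy]; apply Hd, Hy.
Qed.

Lemma coeffs_unique (g : C -> C) (a : nat -> C) :
  has_expansion g a -> forall n, coeffs g n = a n.
Proof.
intros Ha. apply (has_expansion_unique g); [|exact Ha].
unfold coeffs. apply epsilon_spec. now exists a.
Qed.

Definition dirichlet_term (alpha : R) (g : C -> C) (n : nat) : R :=
  Rpower (INR n + 1) (1 - alpha) * Cmod (coeffs g n) ^ 2.

Definition in_dirichlet (alpha : R) (g : C -> C) : Prop :=
  holomorphic_on_disc g /\ (exists a, has_expansion g a) /\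
  ex_series (dirichlet_term alpha g).

Definition dirichlet_norm (alpha : R) (g : C -> C) : R :=
  sqrt (Series (dirichlet_term alpha g)).

Definition comp_diff (phi g : C -> C) : C -> C := fun z => C_derive g (phi z).

(* [dirichlet_norm] takes junk values outside the space, so this is the
   operator norm of T only when T maps the space into itself. *)
Definition op_norm (alpha : R) (T : (C -> C) -> (C -> C)) : Rbar :=
  Lub_Rbar (fun y => exists g : C -> C,
    in_dirichlet alpha g /\ dirichlet_norm alpha g <= 1 /\
    y = dirichlet_norm alpha (T g)).

(* [Rpower 0 y] is 1 for every y in the standard library; the base may vanish
   here, so 0 ^ y = 0 (y <> 0) has to be restored. *)
Definition rpow (x y : R) : R :=
  if Req_EM_T x 0 then (if Req_EM_T y 0 then 1 else 0) else Rpower x y.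

Definition f_aux (alpha : R) (r : C) (x : R) : R :=
  rpow x ((3 - alpha) / 2) * rpow (x + 1) ((alpha - 1) / 2) *
  rpow (Cmod r) (x - 1).

Definition x0 (alpha : R) (r : C) : R :=
  let L := ln (Cmod r) in
  (- (1 + L) - sqrt ((1 + L) ^ 2 - 2 * (3 - alpha) * L)) / (2 * L).

(* Main.v *)
(* For [g = sum a_n z^n], [D_phi g = sum (n + 1) r^n a_(n+1) z^n], so [D_phi] is a
   weighted backward shift: in the orthonormal basis of normalized monomials [e_n]
   it maps [e_n] to a unimodular multiple of [f n * e_(n-1)].  Hence its norm is
   [sup_(n >= 1) f n], attained on the monomial where [f] is largest.  On the
   positive reals [f] increases up to the critical point [x0] and decreases
   afterwards, so the maximum over the integers is at [floor x0] or
   [floor x0 + 1]. *)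
Require Import Defs.
From Stdlib Require Import Reals ZArith Lra Lia.
From Coquelicot Require Import Coquelicot.
Open Scope R_scope.

(** * Complex series: power-series form and norm bounds *)

Lemma is_pseries_C (a : nat -> C) (z l : C) :
  is_pseries (K := C_AbsRing) (V := C_NormedModule) a z l <->
  is_series (K := C_AbsRing) (V := C_NormedModule)
    (fun n => Cmult (Cpow z n) (a n)) l.
Proof.
assert (P : forall n, pow_n (z : C_AbsRing) n = Cpow z n).
{ induction n as [|n IH]; simpl; [reflexivity|]. now rewrite IH. }
split; apply is_series_ext; intros n; [rewrite P|rewrite <- P]; reflexivity.
Qed.

(** Triangle inequality on the partial sums, passed to the limit. It reduces the estimate of a
    complex Taylor remainder to a real majorant series. *)
Lemma is_series_norm_le (u : nat -> C) (l : C) (v : nat -> R) :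
  is_series (K := C_AbsRing) (V := C_NormedModule) u l ->
  (forall n, Cmod (u n) <= v n) -> ex_series v -> Cmod l <= Series v.
Proof.
intros Hu Huv Hv.
apply (is_lim_seq_le (fun N => Cmod (sum_n (G := C_NormedModule) u N)) (sum_n v)
         (Cmod l) (Series v)).
- induction n as [|n IH]; [rewrite !sum_O; apply Huv|].
  rewrite !sum_Sn.
  eapply Rle_trans; [apply Cmod_triangle|].
  apply Rplus_le_compat; [exact IH|apply Huv].
- exact (filterlim_comp _ _ _ _ _ _ _ _ Hu (filterlim_norm (l : C_NormedModule))).
- exact (Series_correct _ Hv).
Qed.

(** * First- and second-order estimates for differences of powers *)

Section PowerDifference.

Variables (w z : C) (s : R).
Hypotheses (Hw : Cmod w <= s) (Hz : Cmod z <= s).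

Lemma Cmod_pow_le (x : C) (n : nat) : Cmod x <= s -> Cmod (Cpow x n) <= s ^ n.
Proof.
intros H; rewrite Cmod_pow.
apply pow_incr; split; [apply Cmod_ge_0|exact H].
Qed.

Lemma Cmod_pow_minus_le (n : nat) :
  Cmod (w ^ n - z ^ n)%C <= INR n * s ^ (n - 1) * Cmod (w - z)%C.
Proof.
assert (Hs : 0 <= s) by (eapply Rle_trans; [apply Cmod_ge_0|exact Hw]).
destruct n as [|n].
{ simpl; replace (1 - 1)%C with (RtoC 0) by ring. rewrite Cmod_0; lra. }
rewrite Nat.sub_succ, Nat.sub_0_r.
induction n as [|n IH].
{ simpl; rewrite !Cmult_1_r; lra. }
replace (w ^ S (S n) - z ^ S (S n))%C
  with (z * (w ^ S n - z ^ S n) + w ^ S n * (w - z))%C by (simpl; ring).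
eapply Rle_trans; [apply Cmod_triangle|].
rewrite !Cmod_mult.
apply Rle_trans with
  (s * (INR (S n) * s ^ n * Cmod (w - z)%C) + s ^ S n * Cmod (w - z)%C).
- apply Rplus_le_compat.
  + apply Rmult_le_compat; auto using Cmod_ge_0.
  + apply Rmult_le_compat_r; [apply Cmod_ge_0|now apply Cmod_pow_le].
- rewrite (S_INR (S n)); simpl pow; apply Req_le; ring.
Qed.

(** Induction on [Rec]: multiplying the previous remainder by [z] leaves an error [(w - z)] times a
    power difference, which the first-order bound makes quadratic in [w - z]. The constant
    [n (n - 1)] is twice the sharp one, but it is the coefficient of a second derivative, whose
    radius of convergence is known. *)
Lemma Cmod_pow_taylor_le (n : nat) :
  Cmod (w ^ n - z ^ n - (w - z) * (INR n * z ^ (n - 1)))%C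
    <= INR n * INR (n - 1) * s ^ (n - 2) * Cmod (w - z)%C ^ 2.
Proof.
assert (Hs : 0 <= s) by (eapply Rle_trans; [apply Cmod_ge_0|exact Hw]).
destruct n as [|[|n]].
{ simpl. replace (1 - 1 - (w - z) * (0 * 1))%C with (RtoC 0) by ring.
  rewrite Cmod_0; lra. }
{ simpl. replace (w * 1 - z * 1 - (w - z) * (1 * 1))%C with (RtoC 0) by ring.
  rewrite Cmod_0; lra. }
replace (S (S n) - 1)%nat with (S n) by lia.
replace (S (S n) - 2)%nat with n by lia.
assert (Hh := Cmod_ge_0 (w - z)%C).
assert (Rec : forall k, (w ^ S (S k) - z ^ S (S k) - (w - z) * (INR (S (S k)) * z ^ S k)
  = z * (w ^ S k - z ^ S k - (w - z) * (INR (S k) * z ^ k))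
    + (w - z) * (w ^ S k - z ^ S k))%C).
{ intros k. rewrite (S_INR (S k)), RtoC_plus; simpl Cpow; ring. }
induction n as [|n IH].
- replace (w ^ 2 - z ^ 2 - (w - z) * (INR 2 * z ^ 1))%C with ((w - z) * (w - z))%C.
  + rewrite Cmod_mult; simpl; nra.
  + change (INR 2) with (1 + 1); rewrite RtoC_plus; simpl; ring.
- rewrite Rec.
  eapply Rle_trans; [apply Cmod_triangle|].
  rewrite !Cmod_mult.
  assert (HP := Cmod_pow_minus_le (S (S n))).
  replace (S (S n) - 1)%nat with (S n) in HP by lia.
  apply Rle_trans with
    (s * (INR (S (S n)) * INR (S n) * s ^ n * Cmod (w - z)%C ^ 2)
     + Cmod (w - z)%C * (INR (S (S n)) * s ^ S n * Cmod (w - z)%C)).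
  + apply Rplus_le_compat.
    * apply Rmult_le_compat; auto using Cmod_ge_0.
    * now apply Rmult_le_compat_l.
  (* With [N = n + 2], the constants add up to [N (N - 1) + N = N^2], which is at most
     [(N + 1) N]. *)
  + apply Rle_trans with (INR (S (S n)) * INR (S (S n)) * s ^ S n * Cmod (w - z)%C ^ 2).
    * rewrite (S_INR (S n)); simpl pow; apply Req_le; ring.
    * assert (0 <= s ^ S n) by now apply pow_le.
      assert (0 <= INR (S (S n))) by apply pos_INR.
      rewrite (S_INR (S (S n))).
      apply Rmult_le_compat_r; [apply pow2_ge_0|].
      apply Rmult_le_compat_r; [assumption|].
      nra.
Qed.

End PowerDifference.

(** * Termwise differentiation of power series on the disc *)

Lemma expansion_CV_radius (g : C -> C) (a : nat -> C) :
  has_expansion g a -> Rbar_le 1 (CV_radius (fun n => Cmod (a n))).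
Proof.
intros Hg.
destruct (CV_radius_bounded (fun n => Cmod (a n))) as [Hub _].
apply Rbar_not_lt_le; intros Hlt.
assert (H0 := CV_radius_ge_0 (fun n => Cmod (a n))).
destruct (CV_radius (fun n => Cmod (a n))) as [c| |]; try (simpl in *; easy).
simpl in Hlt, H0.
(* The midpoint of a supposed radius [c < 1] and [1] still lies in the disc. The series converges
   there, so its terms tend to 0 and are bounded, which forces the radius to be at least this
   midpoint. *)
assert (Hle : Rbar_le ((c + 1) / 2) c); [|simpl in Hle; lra].
apply Hub.
assert (Hx : Cmod (RtoC ((c + 1) / 2)) < 1)
  by (rewrite Cmod_R, Rabs_pos_eq; lra).
specialize (Hg _ Hx); apply is_pseries_C in Hg.
assert (Hl : is_lim_seq (fun n => Cmod (Cpow (RtoC ((c + 1) / 2)) n * a n)%C) 0).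
{ assert (Hc : Cauchy_series (K := C_AbsRing) (V := C_CompleteNormedModule)
    (fun n => Cpow (RtoC ((c + 1) / 2)) n * a n)%C)
    by (apply Cauchy_ex_series; eexists; exact Hg).
  apply is_lim_seq_spec; intros eps.
  destruct (Hc eps) as [N HN]; exists N; intros n Hn.
  specialize (HN n n Hn Hn); rewrite sum_n_n in HN.
  rewrite Rminus_0_r, Rabs_pos_eq by apply Cmod_ge_0; exact HN. }
destruct (filterlim_bounded (V := R_NormedModule) _
  (ex_intro (fun y : R => filterlim _ eventually (locally y)) 0 Hl)) as [M HM].
exists M; intros n; specialize (HM n).
rewrite Cmod_mult, Cmod_pow, Cmod_R, (Rabs_pos_eq ((c + 1) / 2)), Rmult_comm in HM by lra.
exact HM.
Qed.

(* Termwise differentiation: by [Cmod_pow_taylor_le] the remainder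
   [g w - g z - (w - z) d] is at most [|w - z|^2] times a convergent series. *)
Lemma is_derive_expansion (g : C -> C) (a : nat -> C) (z : C) :
  has_expansion g a -> Cmod z < 1 ->
  exists d : C,
    is_pseries (K := C_AbsRing) (V := C_NormedModule)
      (fun n => INR (S n) * a (S n))%C z d /\
    is_derive (K := C_AbsRing) (V := C_NormedModule) g z d.
Proof.
intros Hg Hz.
pose (c := fun n => Cmod (a n)).
assert (Hc : Rbar_le 1 (CV_radius c)) by exact (expansion_CV_radius _ _ Hg).
assert (Hin : forall x, 0 <= x < 1 -> Rbar_lt (Rabs x) (CV_radius c)).
{ intros x Hx; apply Rbar_lt_le_trans with 1; [|exact Hc].
  simpl; rewrite Rabs_pos_eq; lra. }
assert (Hz0 := Cmod_ge_0 z).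
(* Absolute convergence: the moduli of the terms form the derivative of the real power series with
   coefficients [c], which has the same radius. *)
assert (Hd : exists d : C, is_series (K := C_AbsRing) (V := C_NormedModule)
  (fun n => Cpow z n * (INR (S n) * a (S n)))%C d).
{ apply (ex_series_le (V := C_CompleteNormedModule) _
    (fun n => PS_derive c n * Cmod z ^ n)).
  - intros n; apply Req_le.
    change (Cmod (Cpow z n * (INR (S n) * a (S n)))%C = PS_derive c n * Cmod z ^ n).
    rewrite !Cmod_mult, Cmod_pow, Cmod_R, Rabs_pos_eq by apply pos_INR.
    unfold PS_derive, c; ring.
  - apply ex_pseries_R, CV_radius_inside.
    rewrite CV_radius_derive; apply Hin; lra. }
destruct Hd as [d Hd]; exists d; split; [now apply is_pseries_C|].
(* Any radius strictly between [Cmod z] and 1 would do: all [w] near [z] satisfy [Cmod w < s], and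
   the majorant [v], the second derivative of the real series at [s], still converges. *)
set (s := (1 + Cmod z) / 2).
pose (v := fun n => INR n * INR (n - 1) * s ^ (n - 2) * c n).
assert (Hv : ex_series v).
{ apply (ex_series_incr_n v 2).
  apply (ex_series_ext (fun n => PS_derive (PS_derive c) n * s ^ n)).
  - intros n; unfold v, PS_derive.
    replace (2 + n)%nat with (S (S n)) by lia.
    replace (S (S n) - 1)%nat with (S n) by lia.
    replace (S (S n) - 2)%nat with n by lia.
    simpl; ring.
  - apply ex_pseries_R, CV_radius_inside.
    rewrite !CV_radius_derive; apply Hin; unfold s; lra. }
assert (Hv0 : 0 <= Series v).
{ assert (Hpos : forall n, Rabs (v n) = v n).
  { intros n; apply Rabs_pos_eq; unfold v, c; repeat apply Rmult_le_pos;
      auto using pos_INR, Cmod_ge_0; apply pow_le; unfold s; lra. }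
  rewrite <- (Series_ext _ _ Hpos).
  eapply Rle_trans; [apply Rabs_pos|apply Series_Rabs].
  now apply (ex_series_ext v). }
assert (Hrem : forall w, Cmod w < s ->
  Cmod (g w - g z - (w - z) * d)%C <= Series v * Cmod (w - z)%C ^ 2).
{ intros w Hw.
  assert (Hgw : Cmod w < 1) by (unfold s in Hw; lra).
  assert (Sw := proj1 (is_pseries_C _ _ _) (Hg w Hgw)).
  assert (Sz := proj1 (is_pseries_C _ _ _) (Hg z Hz)).
  (* The derivative series is reindexed to line up with those of [g w] and [g z]. The added term at
     [n = 0] vanishes through the factor [INR n], whatever the truncated exponent [n - 1] gives. *)
  assert (Sd : is_series (K := C_AbsRing) (V := C_NormedModule)
    (fun n => z ^ (n - 1) * (INR n * a n))%C d).
  { apply is_series_decr_1.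
    match goal with |- is_series _ ?l => replace l with d end.
    - eapply is_series_ext; [|exact Hd]; intros n; simpl.
      now rewrite Nat.sub_0_r.
    - change (d = (d + - (1 * (0 * a 0%nat)))%C); ring. }
  assert (S1 := is_series_minus _ _ _ _ (is_series_minus _ _ _ _ Sw Sz)
                  (is_series_scal ((w - z)%C : C_AbsRing) _ _ Sd)).
  rewrite <- Series_scal_r.
  apply (is_series_norm_le _ _ _ S1).
  - intros n.
    match goal with |- Cmod ?t <= _ => replace t with
      ((w ^ n - z ^ n - (w - z) * (INR n * z ^ (n - 1))) * a n)%C end.
    + rewrite Cmod_mult.
      replace (v n * Cmod (w - z)%C ^ 2)
        with (INR n * INR (n - 1) * s ^ (n - 2) * Cmod (w - z)%C ^ 2 * c n)
        by (unfold v; ring).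
      apply Rmult_le_compat_r; [apply Cmod_ge_0|].
      apply Cmod_pow_taylor_le; unfold s in *; lra.
    + change ((w ^ n - z ^ n - (w - z) * (INR n * z ^ (n - 1))) * a n
        = w ^ n * a n + - (z ^ n * a n) + - ((w - z) * (z ^ (n - 1) * (INR n * a n))))%C.
      ring.
  - apply ex_series_scal_r, Hv. }
split; [apply is_linear_scal_l|].
(* The definition of differentiability quantifies over every limit [y] of the neighbourhood filter
   of [z]; by separation [y] is [z]. *)
intros y Hy.
apply (is_filter_lim_locally_unique (K := C_AbsRing) (V := AbsRing_NormedModule C_AbsRing)) in Hy.
rewrite <- Hy; clear y Hy.
intros eps.
(* The first bound keeps [w] in the disc of radius [s]; the second makes [Series v * |w - z|] at
   most [eps], the [+ 1] guarding against a zero denominator. *)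
assert (Hdelta : 0 < Rmin ((1 - Cmod z) / 2) (eps / (Series v + 1))).
{ apply Rmin_pos; [lra|]. apply Rdiv_lt_0_compat; [apply cond_pos|lra]. }
exists (mkposreal _ Hdelta); intros w Hw.
change (Cmod (w - z)%C < Rmin ((1 - Cmod z) / 2) (eps / (Series v + 1))) in Hw.
change (Cmod (g w - g z - (w - z) * d)%C <= eps * Cmod (w - z)%C).
assert (Hw1 := Rlt_le_trans _ _ _ Hw (Rmin_l _ _)).
assert (Hw2 := Rlt_le_trans _ _ _ Hw (Rmin_r _ _)).
assert (Hws : Cmod w < s).
{ replace w with (z + (w - z))%C by ring.
  eapply Rle_lt_trans; [apply Cmod_triangle|unfold s; lra]. }
eapply Rle_trans; [apply Hrem, Hws|].
assert (Hh := Cmod_ge_0 (w - z)%C).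
assert (Hk : Cmod (w - z)%C * (Series v + 1) < eps)
  by (apply Rlt_div_r in Hw2; [exact Hw2|lra]).
simpl; nra.
Qed.

Lemma expansion_holomorphic (g : C -> C) (a : nat -> C) :
  has_expansion g a -> holomorphic_on_disc g.
Proof.
intros Hg z Hz; destruct (is_derive_expansion g a z Hg Hz) as (d & _ & Hd).
now exists d.
Qed.

Lemma comp_diff_expansion (r : C) (g : C -> C) (a : nat -> C) :
  Cmod r < 1 -> has_expansion g a ->
  has_expansion (comp_diff (fun z => r * z)%C g)
    (fun n => r ^ n * (INR (S n) * a (S n)))%C.
Proof.
intros Hr Hg z Hz.
assert (Hrz : Cmod (r * z)%C < 1).
{ rewrite Cmod_mult. assert (H1 := Cmod_ge_0 r); assert (H2 := Cmod_ge_0 z); nra. }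
destruct (is_derive_expansion g a _ Hg Hrz) as (d & Hs & Hd).
unfold comp_diff; rewrite (is_C_derive_unique _ _ _ Hd).
apply is_pseries_C; apply is_pseries_C in Hs.
eapply is_series_ext; [|exact Hs]; intros n.
change ((r * z) ^ n * (INR (S n) * a (S n)) =
  z ^ n * (r ^ n * (INR (S n) * a (S n))))%C.
rewrite Cpow_mult_l; ring.
Qed.

(** * The weighted shift and its boundedness *)

Lemma dirichlet_term_expansion (alpha : R) (g : C -> C) (a : nat -> C) (n : nat) :
  has_expansion g a ->
  dirichlet_term alpha g n = Rpower (INR n + 1) (1 - alpha) * Cmod (a n) ^ 2.
Proof.
intros Hg; unfold dirichlet_term; now rewrite (coeffs_unique _ _ Hg).
Qed.

Lemma dirichlet_term_ge_0 (alpha : R) (g : C -> C) (n : nat) :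
  0 <= dirichlet_term alpha g n.
Proof.
apply Rmult_le_pos; [apply Rlt_le, exp_pos|apply pow2_ge_0].
Qed.

Lemma rpow_pos (x y : R) : 0 < x -> rpow x y = Rpower x y.
Proof. intros H; unfold rpow; destruct (Req_EM_T x 0); [lra|reflexivity]. Qed.

Lemma f_aux_exp (alpha : R) (r : C) (x : R) :
  r <> RtoC 0 -> 0 < x ->
  f_aux alpha r x =
  exp ((3 - alpha) / 2 * ln x + (alpha - 1) / 2 * ln (x + 1) + (x - 1) * ln (Cmod r)).
Proof.
intros Hr Hx; apply Cmod_gt_0 in Hr.
unfold f_aux; rewrite !rpow_pos by lra; unfold Rpower.
now rewrite <- !exp_plus.
Qed.

(** The coefficient factor [(n+1)^2 |r|^(2n)] times the ratio of weights [((n+1)/(n+2))^(1-alpha)]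
    is exactly the square of [f] at [n + 1]. *)
Lemma dirichlet_term_comp_diff (alpha : R) (r : C) (g : C -> C) (n : nat) :
  Cmod r < 1 -> r <> RtoC 0 -> (exists a, has_expansion g a) ->
  dirichlet_term alpha (comp_diff (fun z => r * z)%C g) n =
  f_aux alpha r (INR (S n)) ^ 2 * dirichlet_term alpha g (S n).
Proof.
intros Hr Hr0 [a Hg].
rewrite (dirichlet_term_expansion _ _ _ _ (comp_diff_expansion r g a Hr Hg)).
rewrite (dirichlet_term_expansion _ _ _ _ Hg).
assert (HS : 0 < INR (S n)) by apply lt_0_INR, Nat.lt_0_succ.
rewrite (f_aux_exp _ _ _ Hr0 HS).
apply Cmod_gt_0 in Hr0.
rewrite !Cmod_mult, Cmod_pow, Cmod_R, (Rabs_pos_eq (INR (S n))) by lra.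
rewrite <- (Rpower_pow n (Cmod r)) by exact Hr0.
replace (INR n) with (INR (S n) - 1) by (rewrite S_INR; ring).
generalize dependent (INR (S n)); intros x Hx.
replace (x - 1 + 1) with x by ring.
unfold Rpower; simpl.
rewrite !Rmult_1_r.
(* All real powers are gathered into one exponential, with [x^2] written as [exp (ln x + ln x)], so
   that only exponents remain to be compared. *)
transitivity (exp ((1 - alpha) * ln x + ((x - 1) * ln (Cmod r) + (x - 1) * ln (Cmod r))
  + (ln x + ln x)) * (Cmod (a (S n)) * Cmod (a (S n)))).
- rewrite !exp_plus, (exp_ln x Hx); ring.
- rewrite <- !Rmult_assoc, <- !exp_plus.
  do 3 f_equal; field.
Qed.

(** Termwise comparison with [M^2] times the shifted series of [g]; the constant term of [g], killed
    by differentiation, is nonnegative and is added back at the end. Invariance of the space is what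
    gives [op_norm] its intended meaning. *)
Lemma comp_diff_bounded (alpha : R) (r : C) (M : R) (g : C -> C) :
  Cmod r < 1 -> r <> RtoC 0 ->
  (forall n, f_aux alpha r (INR (S n)) <= M) ->
  in_dirichlet alpha g ->
  in_dirichlet alpha (comp_diff (fun z => r * z)%C g) /\
  dirichlet_norm alpha (comp_diff (fun z => r * z)%C g) <= M * dirichlet_norm alpha g.
Proof.
intros Hr Hr0 HM (Hol & Hex & Hser).
assert (Hf : forall n, 0 < f_aux alpha r (INR (S n))).
{ intros n; rewrite f_aux_exp; [apply exp_pos|exact Hr0|].
  apply lt_0_INR, Nat.lt_0_succ. }
assert (HM0 : 0 <= M) by (specialize (Hf 0%nat); specialize (HM 0%nat); lra).
assert (Hle : forall n, 0 <= dirichlet_term alpha (comp_diff (fun z => r * z)%C g) n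
   <= M ^ 2 * dirichlet_term alpha g (S n)).
{ intros n; split; [apply dirichlet_term_ge_0|].
  rewrite dirichlet_term_comp_diff by assumption.
  apply Rmult_le_compat_r; [apply dirichlet_term_ge_0|].
  apply pow_incr; split; [apply Rlt_le, Hf|apply HM]. }
assert (HserS := proj1 (ex_series_incr_1 _) Hser).
assert (HserM : ex_series (fun n => M ^ 2 * dirichlet_term alpha g (S n)))
  by exact (ex_series_scal (M ^ 2) _ HserS).
split; [split; [|split]|].
- destruct Hex as [a Ha].
  exact (expansion_holomorphic _ _ (comp_diff_expansion r g a Hr Ha)).
- destruct Hex as [a Ha]; eexists; exact (comp_diff_expansion r g a Hr Ha).
- apply (ex_series_le (V := R_CompleteNormedModule) _ _) with (2 := HserM).
  intros n; change (Rabs (dirichlet_term alpha (comp_diff (fun z => r * z)%C g) n)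
   <= M ^ 2 * dirichlet_term alpha g (S n)).
  rewrite Rabs_pos_eq; apply Hle.
- unfold dirichlet_norm.
  rewrite <- (sqrt_pow2 M HM0) at 1.
  rewrite <- sqrt_mult_alt by apply pow2_ge_0.
  apply sqrt_le_1_alt.
  eapply Rle_trans; [exact (Series_le _ _ Hle HserM)|].
  rewrite Series_scal_l.
  apply Rmult_le_compat_l; [apply pow2_ge_0|].
  rewrite (Series_incr_1 (dirichlet_term alpha g) Hser).
  assert (H := dirichlet_term_ge_0 alpha g 0); lra.
Qed.

(** * Normalized monomials and attainment of the norm *)

Lemma is_series_single {K : AbsRing} {V : NormedModule K} (u : nat -> V) (k : nat) :
  (forall n, n <> k -> u n = zero) -> is_series u (u k).
Proof.
intros Hu.
assert (Hbelow : forall N, (N < k)%nat -> sum_n u N = zero).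
{ induction N as [|N IH]; intros HN.
  - rewrite sum_O; apply Hu; lia.
  - rewrite sum_Sn, IH, (Hu (S N)) by lia; apply plus_zero_l. }
assert (Habove : forall N, (k <= N)%nat -> sum_n u N = u k).
{ induction N as [|N IH]; intros HN.
  - rewrite sum_O; f_equal; lia.
  - rewrite sum_Sn; destruct (Nat.eq_dec k (S N)) as [->|Hk].
    + rewrite Hbelow by lia; apply plus_zero_l.
    + rewrite IH, (Hu (S N)) by lia; apply plus_zero_r. }
apply (filterlim_ext_loc (fun _ => u k)); [|apply filterlim_const].
exists k; intros N HN; symmetry; now apply Habove.
Qed.

(** The unit vector [e_k]: the square of the scalar cancels the weight [(k+1)^(1-alpha)]. The scalar
    stands on the right to match the single nonzero term of the expansion. *)
Definition normalized_monomial (alpha : R) (k : nat) (z : C) : C :=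
  (z ^ k * Rpower (INR k + 1) ((alpha - 1) / 2))%C.

Lemma normalized_monomial_expansion (alpha : R) (k : nat) :
  has_expansion (normalized_monomial alpha k)
    (fun n => if Nat.eq_dec n k
              then RtoC (Rpower (INR k + 1) ((alpha - 1) / 2)) else RtoC 0).
Proof.
intros z _; apply is_pseries_C.
pose (u := fun n => (z ^ n * if Nat.eq_dec n k
  then RtoC (Rpower (INR k + 1) ((alpha - 1) / 2)) else RtoC 0)%C).
assert (E : u k = normalized_monomial alpha k z)
  by (unfold u; now destruct (Nat.eq_dec k k)).
rewrite <- E; apply (is_series_single (V := C_NormedModule) u).
intros n Hn; unfold u.
destruct (Nat.eq_dec n k); [easy|apply Cmult_0_r].
Qed.

Lemma dirichlet_term_monomial (alpha : R) (k n : nat) :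
  dirichlet_term alpha (normalized_monomial alpha k) n = if Nat.eq_dec n k then 1 else 0.
Proof.
rewrite (dirichlet_term_expansion _ _ _ _ (normalized_monomial_expansion alpha k)).
destruct (Nat.eq_dec n k) as [->|_]; [|rewrite Cmod_0; ring].
rewrite Cmod_R, pow2_abs; unfold Rpower; simpl; rewrite Rmult_1_r, <- !exp_plus.
rewrite <- exp_0; f_equal; field.
Qed.

Lemma monomial_in_dirichlet (alpha : R) (k : nat) :
  in_dirichlet alpha (normalized_monomial alpha k) /\
  dirichlet_norm alpha (normalized_monomial alpha k) = 1.
Proof.
assert (Hs : is_series (dirichlet_term alpha (normalized_monomial alpha k)) 1).
{ replace 1 with (dirichlet_term alpha (normalized_monomial alpha k) k).
  - apply is_series_single; intros n Hn.
    rewrite dirichlet_term_monomial; now destruct (Nat.eq_dec n k).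
  - rewrite dirichlet_term_monomial; now destruct (Nat.eq_dec k k). }
split; [split; [|split]|].
- exact (expansion_holomorphic _ _ (normalized_monomial_expansion alpha k)).
- eexists; apply normalized_monomial_expansion.
- now exists 1.
- unfold dirichlet_norm; rewrite (is_series_unique _ _ Hs); apply sqrt_1.
Qed.

(** Only the term of index [k] survives the shift, with value [f (k+1)^2]; positivity of [f] removes
    the square root. *)
Lemma dirichlet_norm_comp_diff_monomial (alpha : R) (r : C) (k : nat) :
  Cmod r < 1 -> r <> RtoC 0 ->
  dirichlet_norm alpha (comp_diff (fun z => r * z)%C (normalized_monomial alpha (S k)))
  = f_aux alpha r (INR (S k)).
Proof.
intros Hr Hr0; unfold dirichlet_norm.
assert (Ht : forall n, dirichlet_term alpha
    (comp_diff (fun z => r * z)%C (normalized_monomial alpha (S k))) n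
  = f_aux alpha r (INR (S n)) ^ 2 * if Nat.eq_dec (S n) (S k) then 1 else 0).
{ intros n; rewrite dirichlet_term_comp_diff, dirichlet_term_monomial; trivial.
  eexists; apply normalized_monomial_expansion. }
rewrite (Series_ext _ _ Ht).
erewrite is_series_unique by (apply (is_series_single _ k); intros n Hn;
  destruct (Nat.eq_dec (S n) (S k)); [lia|apply Rmult_0_r]).
destruct (Nat.eq_dec (S k) (S k)); [|easy].
rewrite Rmult_1_r; apply sqrt_pow2.
rewrite f_aux_exp; [apply Rlt_le, exp_pos|exact Hr0|].
apply lt_0_INR, Nat.lt_0_succ.
Qed.

Lemma op_norm_comp_diff_max (alpha : R) (r : C) (k : nat) :
  Cmod r < 1 -> r <> RtoC 0 ->
  (forall n, f_aux alpha r (INR (S n)) <= f_aux alpha r (INR (S k))) ->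
  op_norm alpha (comp_diff (fun z => r * z)%C) = f_aux alpha r (INR (S k)).
Proof.
intros Hr Hr0 Hmax; apply is_lub_Rbar_unique; split.
- intros y (g & Hg & Hn & ->).
  destruct (comp_diff_bounded _ _ _ _ Hr Hr0 Hmax Hg) as [_ Hle].
  assert (0 < f_aux alpha r (INR (S k))).
  { rewrite f_aux_exp; [apply exp_pos|exact Hr0|].
    apply lt_0_INR, Nat.lt_0_succ. }
  eapply Rle_trans; [exact Hle|nra].
- intros b Hb; apply Hb.
  destruct (monomial_in_dirichlet alpha (S k)) as [Hin Hnorm].
  exists (normalized_monomial alpha (S k)); repeat split; try apply Hin.
  + rewrite Hnorm; lra.
  + symmetry; now apply dirichlet_norm_comp_diff_monomial.
Qed.

(** * Monotonicity of [f] on either side of [x0] *)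

Lemma exp_monotone (x y : R) : x <= y -> exp x <= exp y.
Proof.
intros [H| ->]; [left; now apply exp_increasing|apply Rle_refl].
Qed.

Section Monotonicity.

Variables (alpha : R) (r : C).
Hypotheses (Halpha : 0 < alpha < 1) (Hr : Cmod r < 1) (Hr0 : r <> RtoC 0).

Let L := ln (Cmod r).
(** On the positive reals, [h] is the logarithm of [f] and [dh] is the derivative of [h]. *)
Let h x := (3 - alpha) / 2 * ln x + (alpha - 1) / 2 * ln (x + 1) + (x - 1) * L.
Let dh x := (3 - alpha) / 2 * / x + (alpha - 1) / 2 * / (x + 1) + L.

Lemma ln_Cmod_neg : L < 0.
Proof.
unfold L; rewrite <- ln_1; apply ln_increasing; [now apply Cmod_gt_0|exact Hr].
Qed.

(** Since [L < 0], the discriminant exceeds [(1 + L)^2], so the square root outweighs [1 + L] and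
    numerator and denominator are both negative. *)
Lemma x0_pos : 0 < x0 alpha r.
Proof.
assert (HL := ln_Cmod_neg).
unfold x0; fold L; simpl.
set (D := (1 + L) * ((1 + L) * 1) - 2 * (3 - alpha) * L).
assert (HD : Rabs (1 + L) < sqrt D).
{ rewrite <- sqrt_Rsqr_abs; apply sqrt_lt_1_alt; split; [apply Rle_0_sqr|].
  unfold D, Rsqr; nra. }
assert (H := Rle_abs (- (1 + L))); rewrite Rabs_Ropp in H.
replace (_ / _) with ((sqrt D + (1 + L)) / (- (2 * L))) by (field; lra).
apply Rdiv_lt_0_compat; lra.
Qed.

(* [x0] is the positive root of the numerator [2 L x^2 + 2 (1 + L) x + 3 - alpha]
   of [2 x (x + 1) h'(x)], whose roots have negative product. *)
Lemma dh_factor (x : R) : 0 < x ->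
  dh x = (x0 alpha r - x) * (- L * x + (3 - alpha) / (2 * x0 alpha r)) / (x * (x + 1)).
Proof.
intros Hx; assert (HL := ln_Cmod_neg); assert (H0 := x0_pos).
assert (Hroot : 2 * L * x0 alpha r ^ 2 + 2 * (1 + L) * x0 alpha r + (3 - alpha) = 0).
{ unfold x0; fold L; cbv zeta.
  set (D := (1 + L) ^ 2 - 2 * (3 - alpha) * L).
  assert (HD : sqrt D * sqrt D = D) by (apply sqrt_sqrt; unfold D; nra).
  replace (2 * L * ((- (1 + L) - sqrt D) / (2 * L)) ^ 2 +
    2 * (1 + L) * ((- (1 + L) - sqrt D) / (2 * L)) + (3 - alpha))
    with ((sqrt D * sqrt D - (1 + L) ^ 2 + 2 * (3 - alpha) * L) / (2 * L))
    by (field; lra).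
  rewrite HD; unfold D; field; lra. }
set (X := x0 alpha r) in *.
(* The root equation divided by [X]. Substituting it for the linear coefficient turns the
   factorization into a rational identity in [L] and [X], free of square roots. *)
assert (Hmid : 2 * (1 + L) = - (2 * L * X) - (3 - alpha) / X).
{ apply (Rmult_eq_reg_r X); [|lra]. field_simplify; lra. }
unfold dh.
replace ((3 - alpha) / 2 * / x + (alpha - 1) / 2 * / (x + 1) + L)
  with ((2 * L * x ^ 2 + 2 * (1 + L) * x + (3 - alpha)) / (2 * (x * (x + 1))))
  by (field; lra).
rewrite Hmid; field; lra.
Qed.

Lemma h_mean_value (x y : R) : 0 < x -> x <= y ->
  exists c, x <= c <= y /\ h y - h x = dh c * (y - x).
Proof.
intros Hx Hxy.
assert (Hd : forall t, x <= t -> is_derive h t (dh t)).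
{ intros t Ht; unfold h, dh; auto_derive; [lra|field; lra]. }
destruct (MVT_gen h x y dh) as (c & Hc & E).
- intros t Ht; rewrite Rmin_left in Ht by lra; apply Hd; lra.
- intros t Ht; rewrite Rmin_left in Ht by lra.
  apply continuity_pt_filterlim, (ex_derive_continuous (K := R_AbsRing) (V := R_NormedModule)).
  eexists; apply Hd; lra.
- rewrite Rmin_left, Rmax_right in Hc by lra; now exists c.
Qed.

(** In [dh_factor] every factor but [x0 - x] is positive because [L < 0], so that factor decides the
    sign of the derivative at the mean value point. *)
Lemma f_aux_incr (x y : R) : 0 < x -> x <= y -> y <= x0 alpha r ->
  f_aux alpha r x <= f_aux alpha r y.
Proof.
intros Hx Hxy Hy; rewrite !f_aux_exp by (assumption || lra).
destruct (h_mean_value x y Hx Hxy) as (c & Hc & E).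
apply exp_monotone; change (h x <= h y).
assert (HL := ln_Cmod_neg).
assert (0 <= dh c); [|nra].
rewrite dh_factor by lra.
assert (0 < (3 - alpha) / (2 * x0 alpha r)) by (apply Rdiv_lt_0_compat; lra).
assert (0 < / (c * (c + 1))) by (apply Rinv_0_lt_compat; nra).
apply Rmult_le_pos; [apply Rmult_le_pos|]; nra.
Qed.

Lemma f_aux_decr (x y : R) : x0 alpha r <= x -> x <= y ->
  f_aux alpha r y <= f_aux alpha r x.
Proof.
assert (H0 := x0_pos).
intros Hx Hxy; rewrite !f_aux_exp by (assumption || lra).
destruct (h_mean_value x y) as (c & Hc & E); [lra..|].
apply exp_monotone; change (h y <= h x).
assert (HL := ln_Cmod_neg).
assert (0 <= - dh c); [|nra].
rewrite dh_factor by lra.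
assert (0 < (3 - alpha) / (2 * x0 alpha r)) by (apply Rdiv_lt_0_compat; lra).
assert (0 < / (c * (c + 1))) by (apply Rinv_0_lt_compat; nra).
unfold Rdiv at 1; rewrite <- !Ropp_mult_distr_l_reverse.
apply Rmult_le_pos; [apply Rmult_le_pos|]; nra.
Qed.

(** A positive integer is either at most the floor, in the increasing range, or at least the floor
    plus one, in the decreasing range. *)
Lemma f_aux_le_floor (n : nat) :
  f_aux alpha r (INR (S n)) <= f_aux alpha r (IZR (Zfloor (x0 alpha r))) \/
  f_aux alpha r (INR (S n)) <= f_aux alpha r (IZR (Zfloor (x0 alpha r)) + 1).
Proof.
assert (Hfl := Zfloor_bound (x0 alpha r)).
assert (HS : 0 < INR (S n)) by apply lt_0_INR, Nat.lt_0_succ.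
rewrite INR_IZR_INZ in *.
destruct (Z.le_gt_cases (Z.of_nat (S n)) (Zfloor (x0 alpha r))) as [H|H].
- left; apply f_aux_incr; [exact HS|now apply IZR_le|lra].
- right; apply f_aux_decr; [lra|].
  rewrite <- plus_IZR; apply IZR_le; lia.
Qed.

End Monotonicity.

(** * The maximizing integer and the norm formula *)

Lemma f_aux_0 (alpha : R) (r : C) : alpha < 3 -> f_aux alpha r 0 = 0.
Proof.
intros H; unfold f_aux, rpow at 1.
destruct (Req_EM_T 0 0); [|lra].
destruct (Req_EM_T ((3 - alpha) / 2) 0); [lra|ring].
Qed.

Theorem theorem1p5 :
  forall (alpha : R) (r : C),
  0 < alpha < 1 -> Cmod r < 1 -> r <> RtoC 0 ->
  let phi := fun z : C => Cmult r z in
  let f := f_aux alpha r in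
  let m := IZR (Zfloor (x0 alpha r)) in
  (forall g : C -> C, in_dirichlet alpha g -> in_dirichlet alpha (comp_diff phi g)) /\
  op_norm alpha (comp_diff phi) =
  Finite
    (if Rlt_dec (f m) (f (m + 1))
     then rpow (m + 1) ((3 - alpha) / 2) * rpow (m + 2) ((alpha - 1) / 2) *
          rpow (Cmod r) m
     else rpow m ((3 - alpha) / 2) * rpow (m + 1) ((alpha - 1) / 2) *
          rpow (Cmod r) (m - 1)).
Proof.
intros alpha r Ha Hr Hr0 phi f m.
assert (Hx0 := x0_pos alpha r Ha Hr Hr0).
assert (Hm0 : (0 <= Zfloor (x0 alpha r))%Z) by (apply Zfloor_lub; lra).
assert (Hmax := f_aux_le_floor alpha r Ha Hr Hr0).
fold f m in Hmax.
assert (Hk : exists k : nat,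
  (forall n, f (INR (S n)) <= f (INR (S k))) /\
  f (INR (S k)) = if Rlt_dec (f m) (f (m + 1)) then f (m + 1) else f m).
{ destruct (Rlt_dec (f m) (f (m + 1))) as [Hlt|Hge].
  (* The maximum is taken at [S k], so [k] is one less than the maximizing integer [m + 1]. *)
  - exists (Z.to_nat (Zfloor (x0 alpha r))).
    rewrite S_INR, INR_IZR_INZ, Z2Nat.id by exact Hm0; fold m.
    split; [|reflexivity].
    intros n; specialize (Hmax n); lra.
  (* If the floor were 0, then [f 0 = 0 < f 1] would put us in the other branch. Hence [m >= 1] and
     [m - 1] is a valid natural index. *)
  - assert (Hm : m <> 0).
    { intros E; rewrite E in Hge; unfold f in Hge; rewrite f_aux_0 in Hge by lra.
      apply Hge; rewrite f_aux_exp; [apply exp_pos|exact Hr0|lra]. }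
    exists (Z.to_nat (Zfloor (x0 alpha r) - 1)).
    replace (INR (S (Z.to_nat (Zfloor (x0 alpha r) - 1)))) with m.
    + split; [|reflexivity].
      intros n; specialize (Hmax n); lra.
    + assert (Zfloor (x0 alpha r) <> 0%Z) by (intros E; apply Hm; unfold m; now rewrite E).
      rewrite S_INR, INR_IZR_INZ, Z2Nat.id by lia.
      rewrite minus_IZR; fold m; ring. }
destruct Hk as (k & Hkmax & Hkval).
split.
- intros g Hg; exact (proj1 (comp_diff_bounded alpha r _ g Hr Hr0 Hkmax Hg)).
- unfold phi; rewrite (op_norm_comp_diff_max alpha r k Hr Hr0 Hkmax).
  fold f; rewrite Hkval; f_equal.
  destruct (Rlt_dec (f m) (f (m + 1))); [|reflexivity].
  unfold f, f_aux.
  replace (m + 1 + 1) with (m + 2) by ring; now replace (m + 1 - 1) with m by ring.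
Qed.
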